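(* Let $f:M\to M$ be a continuous map on a compact, finite-dimensional manifold $M$, and let $\Phi=\{\phi_n\}_{n\ge 1}$ be a subadditive potential on $M$. Let $\mu$ be any observable measure for $f$. If the growth rates of $\Phi$ satisfy $$\Phi^*(x):=\lim_{n\to\infty}\frac1n\phi_n(x)<0\quad\text{for }\mu\text{-a.e. }x\in M,$$ then $\widehat\Phi^*(x)<0$ on a set of points $x$ with positive Lebesgue measure.
   Context: Lebesgue measure means a normalized Lebesgue measure $m$ on $M$. $\mathcal M$ denotes the set of all Borel probability measures on $M$ with the weak$^*$ topology, and $\mathrm{dist}^*$ is a fixed metric on $\mathcal M$ inducing this topology. $\mathcal N_\epsilon(\mu)$ is the $\epsilon$-neighborhood of $\mu\in\mathcal M$ in the metric $\mathrm{dist}^*$. For $x\in M$, the empirical measures are $\delta_{x,n}=\frac1n\sum_{j=0}^{n-1}\delta_{f^j(x)}$, where $\delta_y$ is the Dirac measure at $y$. $\mathcal V_f(x)$ is the set of all weak$^*$ limits of convergent subsequences of $(\delta_{x,n})_{n\ge1}$. A measure $\mu\in\mathcal M$ is observable for $f$ if for all $\epsilon>0$ the set $A_\epsilon(\mu)=\{x\in M:\mathcal V_f(x)\cap\mathcal N_\epsilon(\mu)\neq\emptyset\}$ has positive Lebesgue measure. (Observable measures are $f$-invariant and always exist for continuous $f$.) A subadditive potential on $M$ is a sequence $\Phi=\{\phi_n\}_{n\ge1}$ of continuous real functions on $M$ with $\phi_{n+m}(x)\le\phi_n(x)+\phi_m(f^n x)$ for all $x\in M$ and $n,m\in\mathbb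 N$ (positive integers). By Kingman's subadditive ergodic theorem the limit $\Phi^*(x)$ exists (possibly $-\infty$) for $\mu$-a.e. $x$, for every $f$-invariant probability $\mu$. The smallest growth rate at any $x\in M$ is $\widehat\Phi^*(x):=\liminf_{n\to\infty}\frac1n\phi_n(x)$. *)

(* Defs.v *)
From HB Require Import structures.
From mathcomp Require Import all_boot all_order all_algebra.
From mathcomp Require Import all_classical all_reals all_analysis.

Set Implicit Arguments.
Unset Strict Implicit.
Unset Printing Implicit Defensive.

Import Order.TTheory GRing.Theory Num.Theory.
Import numFieldNormedType.Exports.

Local Open Scope classical_set_scope.
Local Open Scope ring_scope.

Section lebesgue_tuple_step.
Context (R : realType) (n : nat).
Local Notation RR := (measurableTypeR R).
Variable mu : {sigma_finite_measure set (n.-tuple RR) -> \bar R}.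

Definition tuple_cons (p : RR * n.-tuple RR) : n.+1.-tuple RR :=
  [tuple of p.1 :: p.2].

Definition lebesgue_cons : set (n.+1.-tuple RR) -> \bar R :=
  pushforward (@lebesgue_measure R \x mu)%E tuple_cons.

Let measurable_tuple_cons : measurable_fun setT tuple_cons.
Proof. exact: measurable_cons measurable_fst measurable_snd. Qed.

Let measurable_preimage (A : set (n.+1.-tuple RR)) :
  measurable A -> measurable (tuple_cons @^-1` A).
Proof. by move=> mA; rewrite -[X in measurable X]setTI; exact: measurable_tuple_cons. Qed.

Let lebesgue_cons0 : lebesgue_cons set0 = 0%E.
Proof. by rewrite /lebesgue_cons /pushforward preimage_set0 measure0. Qed.

Let lebesgue_cons_ge0 A : (0 <= lebesgue_cons A)%E.
Proof. exact: measure_ge0. Qed.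

Let lebesgue_cons_sigma_additive : semi_sigma_additive lebesgue_cons.
Proof.
move=> F mF tF mUF; rewrite /lebesgue_cons /pushforward preimage_bigcup.
apply: measure_semi_sigma_additive.
- by move=> k; exact: measurable_preimage.
- apply/trivIsetP => /= i j _ _ ij; rewrite -preimage_setI.
  by move/trivIsetP : tF => /(_ _ _ _ _ ij) ->//; rewrite preimage_set0.
- by rewrite -preimage_bigcup; exact: measurable_preimage.
Qed.

HB.instance Definition _ := isMeasure.Build _ _ _ lebesgue_cons
  lebesgue_cons0 lebesgue_cons_ge0 lebesgue_cons_sigma_additive.

Let lebesgue_cons_sigma_finite : sigma_finite setT lebesgue_cons.
Proof.
have /sigma_finiteP[F [UF ndF mF]] := sigma_finiteT (@lebesgue_measure R).
have /sigma_finiteP[G [UG ndG mG]] := sigma_finiteT mu.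
pose uncons (t : n.+1.-tuple RR) : RR * n.-tuple RR :=
  (thead t, [tuple of behead t]).
have munc : measurable_fun setT uncons.
  by apply/measurable_fun_pair => /=;
    [exact: measurable_tnth|exact: measurable_behead].
exists (fun k => uncons @^-1` (F k `*` G k)).
  rewrite -preimage_bigcup; apply/esym/seteqP; split=> // t _.
  have [i _ Fi] : (\bigcup_k F k) (uncons t).1 by rewrite -UF.
  have [j _ Gj] : (\bigcup_k G k) (uncons t).2 by rewrite -UG.
  exists (maxn i j) => //; split.
    by apply: (subsetPset _ _ (ndF _ _ (leq_maxl i j))).
  by apply: (subsetPset _ _ (ndG _ _ (leq_maxr i j))).
move=> k; have [mFk Fk] := mF k; have [mGk Gk] := mG k; split.
  by rewrite -[X in measurable X]setTI; apply: munc => //; exact: measurableX.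
rewrite /lebesgue_cons /pushforward -comp_preimage.
have -> : uncons \o tuple_cons = id.
  by apply/funext => -[x t]; congr pair; apply/val_inj.
by rewrite preimage_id product_measure1E// lte_mul_pinfty// ge0_fin_numE.
Qed.

HB.instance Definition _ := Measure_isSigmaFinite.Build _ _ _ lebesgue_cons
  lebesgue_cons_sigma_finite.

End lebesgue_tuple_step.

(* The Lebesgue measure of R^n as the n-fold product of [lebesgue_measure]; for
   n = 0 it is the unit mass on the one-point space. *)
Fixpoint lebesgue_tuple (R : realType) (n : nat) :
    {sigma_finite_measure set (n.-tuple (measurableTypeR R)) -> \bar R} :=
  match n with
  | 0 => [the {sigma_finite_measure set _ -> \bar R} of dirac [tuple]]
  | n'.+1 =>
      [the {sigma_finite_measure set _ -> \bar R} of
        lebesgue_cons (lebesgue_tuple R n')]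
  end.

(* A chart of [M] modelled on R^d: a homeomorphism [cmap] from the open set
   [cdom] onto the open set [crange], with inverse [cinv]; the values of [cmap]
   outside [cdom] and of [cinv] outside [crange] are irrelevant. *)
Record chart (R : realType) (d : nat) (M : topologicalType) := Chart {
  cdom : set M;
  cmap : M -> 'rV[R]_d;
  cinv : 'rV[R]_d -> M }.

Definition crange R d M (c : chart R d M) : set 'rV[R]_d := cmap c @` cdom c.

Definition is_chart R d M (c : chart R d M) : Prop :=
  [/\ open (cdom c), open (crange c),
      {in cdom c, cancel (cmap c) (cinv c)},
      {within cdom c, continuous (cmap c)} &
      {within crange c, continuous (cinv c)}].

Definition C1_on (R : realType) (d : nat) (U : set 'rV[R]_d)
    (g : 'rV[R]_d -> 'rV[R]_d) : Prop :=
  (forall y, U y -> differentiable g y) /\ {within U, continuous (jacobian g)}.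

Definition C1_compatible R d M (c c' : chart R d M) : Prop :=
  C1_on (cmap c @` (cdom c `&` cdom c')) (cmap c' \o cinv c).

(* [M] with the atlas [A] is a d-dimensional manifold without boundary, of
   class C^1. A smooth atlas is in particular a C^1 atlas, and C^1 transition
   maps suffice for the notion of Lebesgue measure used below. *)
Definition is_manifold (R : realType) (d : nat) (M : topologicalType)
    (A : set (chart R d M)) : Prop :=
  [/\ hausdorff_space M, @second_countable M,
      (forall c, A c -> is_chart c),
      (forall x, exists2 c, A c & cdom c x) &
      (forall c c', A c -> A c' -> C1_compatible c c')].

Notation borel M := (g_sigma_algebraType (@open M)).

(* The points of R^d are row vectors in charts, and tuples in
   [lebesgue_tuple]. *)
Definition rV_of_tuple (R : realType) (d : nat)
    (t : d.-tuple (measurableTypeR R)) : 'rV[R]_d := \row_i tnth t i.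

(* A normalized Lebesgue measure on a manifold is a Borel probability measure
   having, in every chart, a continuous positive density with respect to the
   Lebesgue measure of R^d (e.g. a normalized Riemannian volume). *)
Definition is_lebesgue_measure (R : realType) (d : nat) (M : ptopologicalType)
    (A : set (chart R d M)) (m : probability (borel M) R) : Prop :=
  forall c, A c -> exists rho : 'rV[R]_d -> R,
    [/\ {within crange c, continuous rho},
        (forall y, crange c y -> 0 < rho y) &
        forall B : set (borel M), measurable B -> B `<=` cdom c ->
          m B = (\int[lebesgue_tuple R d]_(t in
                   @rV_of_tuple R d @^-1` (cmap c @` B))
                   (rho (rV_of_tuple t))%:E)%E].

Definition integrate (R : realType) (M : ptopologicalType)
    (mu : probability (borel M) R) : {ptws continuousType M R -> R} :=
  fun g => \int[mu]_x g x.

(* The set of Borel probability measures with the weak* topology, i.e. the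
   coarsest topology making [mu |-> \int[mu]_x g x] continuous for every
   continuous [g : M -> R]. *)
Definition weak_star (R : realType) (M : ptopologicalType) : topologicalType :=
  initial_topology (@integrate R M).

(* [dist] is a metric inducing the weak* topology. Measures are identified when
   they agree on Borel sets: the carrier of [probability] also records
   unspecified values on non-measurable sets. *)
Definition weak_star_metric (R : realType) (M : ptopologicalType)
    (dist : probability (borel M) R -> probability (borel M) R -> R) : Prop :=
  [/\ (forall mu nu, dist mu nu = 0 <->
         (forall B, measurable B -> mu B = nu B)),
      (forall mu nu, dist mu nu = dist nu mu),
      (forall mu nu xi, dist mu xi <= dist mu nu + dist nu xi) &
      (forall mu : probability (borel M) R,
         nbhs (mu : weak_star R M) =
         filter_from [set e : R | 0 < e]
           (fun e => [set nu | dist mu nu < e]))].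

Section empirical_measure.
Context (R : realType) (M : ptopologicalType) (f : M -> M) (x : M) (n : nat).

(* The empirical measure of the first n + 1 points of the orbit of [x]: the
   offset leaves out the meaningless n = 0. *)
Definition empirical : set (borel M) -> \bar R :=
  mscale (n.+1%:R^-1)%:nng
    (msum (fun j => @dirac _ (borel M) (iter j f x) R) n.+1).

HB.instance Definition _ := Measure.on empirical.

Let empirical_setT : empirical setT = 1%E.
Proof.
transitivity ((n.+1%:R^-1)%:E *
    \sum_(j < n.+1) @dirac _ (borel M) (iter j f x) R setT)%E; first by [].
under eq_bigr do rewrite diracT.
by rewrite sumEFin -EFinM sumr_const card_ord mulVf ?pnatr_eq0.
Qed.

HB.instance Definition _ :=
  Measure_isProbability.Build _ _ _ empirical empirical_setT.

End empirical_measure.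

(* The set of weak* limits of convergent subsequences of the empirical
   measures. *)
Definition empirical_limits (R : realType) (M : ptopologicalType) (f : M -> M)
    (x : M) : set (probability (borel M) R) :=
  [set nu | exists2 s : nat -> nat, {homo s : i j / (i < j)%N} &
     (fun k => empirical R f x (s k) : weak_star R M) @ \oo -->
       (nu : weak_star R M)].

Definition observable_basin (R : realType) (M : ptopologicalType) (f : M -> M)
    (dist : probability (borel M) R -> probability (borel M) R -> R)
    (mu : probability (borel M) R) (e : R) : set M :=
  [set x | empirical_limits (R := R) f x `&` [set nu | dist mu nu < e] !=set0].

(* [mu_ext m], the outer measure of [m], coincides with [m] on Borel sets and is
   meaningful for sets not known a priori to be Borel. *)
Definition observable (R : realType) (M : ptopologicalType)
    (m : probability (borel M) R) (f : M -> M)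
    (dist : probability (borel M) R -> probability (borel M) R -> R)
    (mu : probability (borel M) R) : Prop :=
  forall e : R, 0 < e ->
    (0 < mu_ext m (observable_basin f dist mu e : set (borel M)))%E.

(* [Phi 0] is irrelevant. *)
Definition subadditive_potential (R : realType) (M : topologicalType)
    (f : M -> M) (Phi : nat -> M -> R) : Prop :=
  (forall n, (0 < n)%N -> continuous (Phi n)) /\
  (forall n k, (0 < n)%N -> (0 < k)%N ->
     forall x, Phi (n + k)%N x <= Phi n x + Phi k (iter n f x)).

Definition growth (R : realType) (M : Type) (Phi : nat -> M -> R) (x : M) :
    (\bar R)^nat :=
  fun n => (Phi n x / n%:R)%:E.

(* Main.v *)
Require Import Defs.
From HB Require Import structures.
From mathcomp Require Import all_boot all_order all_algebra.
From mathcomp Require Import all_classical all_reals all_analysis.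
From mathcomp Require Import measurable_realfun lra zify.

(* Since phi_n / n is bounded above by max phi_1, the reverse Fatou lemma turns
   the a.e. negativity of its limit into \int phi_n dmu < 0 for some n, an
   inequality shared by all measures nu weak*-close to mu. If such a nu is a
   limit of empirical measures of x, the Birkhoff averages of phi_n along the
   orbit of x are negative, bounded away from 0, along a subsequence of times N;
   these averages dominate n phi_N(x) / N up to O(1/N), so
   liminf phi_N(x) / N < 0. Hence the basin of a small ball around mu lies in
   the Borel set where the liminf is negative. *)

Set Implicit Arguments.
Unset Strict Implicit.

Import Order.TTheory GRing.Theory Num.Theory.
Import numFieldNormedType.Exports.

Local Open Scope classical_set_scope.
Local Open Scope ring_scope.

(** * Lower limits and a reverse Fatou argument *)

Lemma limn_einf_le (R : realType) (u : (\bar R)^nat) (c : \bar R) :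
  (forall n, exists2 k, (n <= k)%N & (u k <= c)%E) -> (limn_einf u <= c)%E.
Proof.
move=> uc; rewrite limn_einf_lim; apply: lime_le; first exact: is_cvg_einfs.
apply: nearW => n; have [k nk ukc] := uc n.
by apply: le_trans ukc; apply: ereal_inf_lbound; exists k.
Qed.

Lemma limn_einf_ge (R : realType) (u : (\bar R)^nat) (c : \bar R) :
  (forall n, c <= u n)%E -> (c <= limn_einf u)%E.
Proof.
move=> uc; rewrite limn_einf_lim; apply: lime_ge; first exact: is_cvg_einfs.
by apply: nearW => n; apply: le_ereal_inf_tmp => _ [k _ <-].
Qed.

Lemma measurable_fun_limn_einf d (T : measurableType d) (R : realType)
    (D : set T) (u : (T -> \bar R)^nat) :
  (forall n, measurable_fun D (u n)) ->
  measurable_fun D (fun x => limn_einf (u^~ x)).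
Proof.
move=> mu; apply: measurableT_comp => //.
by apply: measurable_fun_limn_esup => n; exact: measurableT_comp.
Qed.

(** Fatou's lemma for the nonnegative functions [C' - u n]. If the integrals were eventually
    nonnegative, those of [C' - u n] would have lower limit at most [C'], whereas the lower limit of
    the functions is [C' + w] with [w > 0] a.e. *)
Lemma frequently_Rintegral_lt0 d (T : measurableType d) (R : realType)
    (mu : probability T R) (u : (T -> R)^nat) (C : R) :
  (forall n, mu.-integrable setT (EFin \o u n)) ->
  (forall n x, u n x <= C) ->
  {ae mu, forall x, (limn_esup (fun n => (u n x)%:E) < 0)%E} ->
  forall N, exists2 n, (N <= n)%N & \int[mu]_x u n x < 0.
Proof.
move=> iu uC uneg N; apply: contrapT => /forall2NP noN.
have int_ge0 n : (N <= n)%N -> 0 <= \int[mu]_x u n x.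
  by move=> Nn; have [/(_ Nn)|/negP] := noN n => //; rewrite -leNgt.
have mu_ n : measurable_fun setT (fun x => (u n x)%:E).
  exact: (measurable_int mu (iu n)).
have muT : mu setT = 1%E by exact: probability_setT.
(* The absolute value makes the constant nonnegative, so that the integral of [C' + maxe (w x) 0]
   can be split below. *)
pose C' : R := `|C|; have C'0 : 0 <= C' by exact: normr_ge0.
have intC' : (\int[mu]_x C'%:E = C'%:E)%E.
  by rewrite integral_cst//= [X in (_ * X)%E]probability_setT mule1.
have uC' n x : u n x <= C' by rewrite (le_trans (uC n x))// ler_norm.
pose w x := limn_einf (fun n => (- u n x)%:E).
have mw : measurable_fun setT w.
  apply: measurable_fun_limn_einf => n.
  rewrite -[X in measurable_fun _ X]/(fun x => - (u n x)%:E)%E.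
  exact: measurableT_comp.
have w0 : {ae mu, forall x, (0 < w x)%E}.
  apply: filterS uneg => x ux.
  by rewrite /w (limn_einfN (fun n => (u n x)%:E)) oppe_gt0.
pose g n x := (C' - u n x)%:E.
have g0 n x : (0 <= g n x)%E by rewrite lee_fin subr_ge0.
have gE x : limn_einf (g^~ x) = (C'%:E + w x)%E by rewrite -limn_einf_shift.
have mg n : measurable_fun setT (g n).
  apply/measurable_EFinP/measurable_funB => //.
  by apply/measurable_EFinP; exact: mu_.
(* It remains to prove the strict reverse of Fatou's inequality. *)
have := fatou mu measurableT mg (fun n x _ => g0 n x).
rewrite leNgt => /negP; apply.
have Lle : (limn_einf (fun n => \int[mu]_x g n x) <= C'%:E)%E.
  apply: limn_einf_le => n; exists (maxn n N); first exact: leq_maxl.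
  have -> : (\int[mu]_x g (maxn n N) x = (C' - \int[mu]_x u (maxn n N) x)%:E)%E.
    rewrite /g; under eq_integral do rewrite EFinB.
    rewrite integralB_EFin//; last exact: finite_measure_integrable_cst.
    rewrite intC' EFinB.
    by rewrite fineK//; exact: (integrable_fin_num measurableT (iu _)).
  by rewrite lee_fin lerBlDr lerDl int_ge0// leq_maxr.
apply: le_lt_trans Lle _.
(* Truncating [w] at 0 changes it only on a null set. *)
have -> : (\int[mu]_x limn_einf (g^~ x) = \int[mu]_x (C'%:E + maxe (w x) 0))%E.
  apply: ge0_ae_eq_integral => //.
  - exact: measurable_fun_limn_einf.
  - by apply: emeasurable_funD => //; apply: measurable_maxe.
  - by move=> x _; apply: limn_einf_ge.
  - by move=> x _; rewrite adde_ge0// ?lee_fin// le_max lexx orbT.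
  - apply: filterS w0 => x wx _; rewrite gE; congr (_ + _)%E.
    by rewrite max_l// ltW.
have w'0 x : (0 <= maxe (w x) 0)%E by rewrite le_max lexx orbT.
have mw' : measurable_fun setT (fun x => maxe (w x) 0%E).
  exact: measurable_maxe.
(* Strictness: a zero integral would force [w] to vanish where it is positive, that is a.e., making
   the whole space null. *)
rewrite ge0_integralD// intC' lteDl// lt0e integral_ge0// andbT; apply/eqP => iw0.
have /ae_eq_integral_abs : (\int[mu]_x `|maxe (w x) 0| = 0)%E.
  by rewrite -[RHS]iw0; apply: eq_integral => x _; rewrite gee0_abs.
move=> /(_ measurableT mw') w'E.
have : {ae mu, forall x : T, False}.
  apply: filterS2 w0 w'E => x wx /(_ I); rewrite max_l ?ltW// => wx0.
  by move: wx; rewrite wx0 ltxx.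
move=> [Z [mZ Z0 TZ]].
have := muT; rewrite (_ : setT = Z).
  by rewrite Z0 => /eqP; rewrite eq_sym onee_eq0.
by apply/seteqP; split => // x _; apply: TZ.
Qed.

(** * Integrals of continuous functions on a compact space *)

Section borel.
Context (R : realType) (M : ptopologicalType).

Lemma continuous_borel_measurable (g : M -> R) :
  continuous g -> measurable_fun [set: borel M] g.
Proof.
move=> /continuousP cg; apply: (measurability _ (RGenOpens.measurableE R)).
move=> _ [_ [a [b ->] <-]]; rewrite setTI.
apply: sub_sigma_algebra; exact/cg/interval_open.
Qed.

Hypothesis cptM : compact [set: M].

Lemma continuous_bounded (g : M -> R) : continuous g ->
  exists B, forall x, `|g x| <= B.
Proof.
move=> cg; have /compact_bounded[B [_ gB]] : compact (g @` setT).
  by apply: continuous_compact => //; exact: continuous_subspaceT.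
exists (`|B| + 1) => x; apply: gB; last by exists x.
by rewrite (le_lt_trans (ler_norm B))// ltrDl.
Qed.

Lemma continuous_borel_integrable (g : M -> R) (mu : probability (borel M) R) :
  continuous g -> mu.-integrable setT (EFin \o g).
Proof.
move=> cg; apply: measurable_bounded_integrable => //.
- by rewrite [X in (X < _)%E]probability_setT ltry.
- exact: continuous_borel_measurable.
- have [B gB] := continuous_bounded cg.
  exists B; split; first exact: num_real.
  by move=> b Bb x _; exact: le_trans (gB x) (ltW Bb).
Qed.

Lemma Rintegral_empirical (f : M -> M) (x : M) (n : nat) (g : M -> R) :
  continuous g ->
  \int[empirical R f x n]_y g y =
    (\sum_(j < n.+1) g (iter j f x)) / n.+1%:R.
Proof.
move=> cg; have [B gB] := continuous_bounded cg.
have igP (P : probability (borel M) R) := continuous_borel_integrable P cg.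
have mg := continuous_borel_measurable cg.
pose P : probability (borel M) R := empirical R f x n.
(* Adding the bound [B] makes the integrand nonnegative, as integration against scaled measures and
   sums of measures requires. *)
have intD : \int[P]_y (g y + B) = \int[P]_y g y + B.
  rewrite RintegralD//; [|exact: igP|exact: finite_measure_integrable_cst].
  by rewrite Rintegral_cst// [X in fine X]probability_setT mulr1.
apply: (addIr B); rewrite -intD.
have gB0 y : 0 <= g y + B.
  by rewrite -lerBlDr sub0r; have := gB y; rewrite ler_norml => /andP[].
have mgB : measurable_fun [set: borel M] (fun y => (g y + B)%:E).
  by apply/measurable_EFinP; exact: measurable_funD.
rewrite /Rintegral /P /empirical ge0_integral_mscale//; last first.
  by move=> y _; rewrite lee_fin.
rewrite ge0_integral_measure_sum//; last by move=> y _; rewrite lee_fin.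
under eq_bigr do rewrite integral_dirac// diracT mul1e.
rewrite sumEFin -EFinM/= big_split/= sumr_const card_ord mulrDr mulrC.
by rewrite -[B *+ _]mulr_natl mulKf ?pnatr_eq0.
Qed.

Lemma integrate_continuous (g : M -> R) : continuous g ->
  continuous (fun nu : weak_star R M =>
    \int[nu : probability (borel M) R]_x g x).
Proof.
move=> cg.
(* Once packed, [g] is an index of the product carrying the pointwise topology, and integrating it
   is a coordinate projection after [integrate]. *)
pose cg' := isContinuous.Build M R g cg.
pose G : continuousType M R := HB.pack g cg'.
have ci : continuous (@integrate R M : weak_star R M -> _).
  exact: initial_continuous.
have cp := @proj_continuous (continuousType M R) (fun=> R) G.
move=> nu.
exact: (@cvg_comp _ _ _ _ _ _ _ _ (ci nu) (cp (integrate nu))).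
Qed.

End borel.

(** * Subadditive potentials and Birkhoff sums *)

Section subadditive.
Context (R : realType) (M : topologicalType) (f : M -> M) (Phi : nat -> M -> R).
Hypothesis hPhi : subadditive_potential f Phi.

Lemma subadditive_potential_le_linear (C : R) :
  (forall x, Phi 1%N x <= C) -> forall n x, (0 < n)%N -> Phi n x <= C * n%:R.
Proof.
move=> PhiC; elim=> [//|[|n] IH] x _; first by rewrite mulr1.
rewrite -[n.+2]addn1 natrD mulrDr mulr1 (le_trans (hPhi.2 _ _ _ _ _))//.
by rewrite lerD// IH.
Qed.

(* Compare U N, the sum of phi_{N-i} o f^i over i < n, with the Birkhoff sum
   S N: passing from (N - n, f^n x) to (N, x) adds S n x to S and at most S n x
   to U. *)
Lemma subadditive_potential_le_birkhoff (n : nat) (B : R) : (0 < n)%N ->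
  (forall k x, (0 < k < n.*2)%N -> `|Phi k x| <= B) ->
  forall N x, (n <= N)%N ->
    Phi N x * n%:R <= \sum_(j < N) Phi n (iter j f x) + 4 * n%:R * B.
Proof.
move=> n0 PhiB.
have sum_cst k c : k%:R * c = \sum_(i < k) c :> R.
  by rewrite sumr_const card_ord mulr_natl.
pose S N x := \sum_(j < N) Phi n (iter j f x).
pose U N x := \sum_(i < n) Phi (N - i)%N (iter i f x).
(* Split phi_N at each time i < n; the first piece is at most [B]. The case i = 0 is separate
   because [Phi 0] is unconstrained. *)
have PhiU N x : (n <= N)%N -> Phi N x * n%:R <= U N x + n%:R * B.
  move=> nN; rewrite mulrC !sum_cst -big_split/=.
  apply: ler_sum => -[i ilt] _ /=.
  have [->|i0] := posnP i.
    rewrite subn0 lerDl (le_trans (normr_ge0 (Phi n x)))// PhiB//.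
    by rewrite n0 -addnn -ltn_subLR// subnn.
  rewrite -{1}(subnKC (ltnW (leq_trans ilt nN))) addrC.
  rewrite (le_trans (hPhi.2 _ _ i0 _ _))//.
    by rewrite subn_gt0 (leq_trans ilt).
  rewrite lerD2r (le_trans (ler_norm _))// PhiB// i0 -addnn.
  exact: ltn_addr.
suff US N x : (n <= N)%N -> U N x <= S N x + 3 * n%:R * B.
  move=> N x nN; rewrite (le_trans (PhiU N x nN))//.
  have := US N x nN; rewrite /S; lra.
(* Induction in steps of [n]. For n <= N < 2n all terms are bounded by [B]: U is at most nB and S at
   least -2nB, whence the constant 3. *)
elim/ltn_ind: N x => N IH x nN; have [N2n|n2N] := ltnP N n.*2.
  have B0 : 0 <= B.
    rewrite (le_trans (normr_ge0 (Phi n x)))// PhiB//.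
    by rewrite n0 (leq_ltn_trans nN).
  have UB : U N x <= n%:R * B.
    rewrite sum_cst.
    apply: ler_sum => -[i ilt] _ /=; rewrite (le_trans (ler_norm _))// PhiB//.
    by rewrite subn_gt0 (leq_trans ilt)//= (leq_ltn_trans (leq_subr _ _)).
  have SB : - (N%:R * B) <= S N x.
    rewrite lerNl sum_cst -sumrN.
    apply: ler_sum => j _; rewrite (le_trans (ler_norm _))// normrN PhiB//.
    by rewrite n0 (leq_ltn_trans nN).
  have : N%:R * B <= (n%:R + n%:R) * B.
    by rewrite ler_wpM2r// -natrD addnn ler_nat ltnW.
  lra.
have nNn : (n <= N - n)%N by rewrite leq_subRL// addnn.
have SE k : S (n + k)%N x = S n x + S k (iter n f x).
  rewrite /S big_split_ord/=; congr (_ + _).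
  by apply: eq_bigr => j _; rewrite addnC iterD.
(* Each term of U sheds a block of length [n]; the rest has positive length since N >= 2n > n +
   i. *)
have UE : U N x <= S n x + U (N - n)%N (iter n f x).
  rewrite /U /S -big_split/=; apply: ler_sum => -[i ilt] _ /=.
  have -> : (N - i = n + (N - n - i))%N by lia.
  rewrite (le_trans (hPhi.2 _ _ n0 _ _))//; first by lia.
  by rewrite -!iterD addnC.
rewrite (le_trans UE)// -[in S N x](subnKC nN) SE -addrA lerD2l IH//; lia.
Qed.
End subadditive.

(** * Negative integrals and negative growth rates *)

Section growth.
Context (R : realType) (M : ptopologicalType) (cptM : compact [set: M]).
Context (f : M -> M) (Phi : nat -> M -> R).
Hypothesis hPhi : subadditive_potential f Phi.

Lemma measurable_fun_growth (n : nat) :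
  measurable_fun [set: borel M] (growth Phi ^~ n).
Proof.
(* At index 0 the quotient is 0, since the inverse of 0 is 0. *)
apply/measurable_EFinP; case: n => [|n].
  by rewrite (_ : (fun _ => _) = cst 0)//; apply/funext => x;
    rewrite invr0 mulr0.
apply: measurable_funM => //; apply: continuous_borel_measurable.
exact: hPhi.1.
Qed.

Lemma exists_Rintegral_lt0 (mu : probability (borel M) R) :
  {ae mu, forall x : borel M,
    exists2 l : \bar R, growth Phi x @ \oo --> l & (l < 0)%E} ->
  (* The shift by one drops [Phi 0] and keeps the limit. *)
  exists2 n, (0 < n)%N & \int[mu]_x Phi n x < 0.
Proof.
move=> hneg; pose u n x := Phi n.+1 x / n.+1%:R.
have [C PhiC] := continuous_bounded cptM (hPhi.1 1%N isT).
have cu n : continuous (u n).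
  by move=> x; apply: cvgM; [exact: hPhi.1|exact: cvg_cst].
have [n _ un0] : exists2 n, (0 <= n)%N & \int[mu]_x u n x < 0.
  apply: (@frequently_Rintegral_lt0 _ _ _ mu u C) => [n|n x|].
  - by apply: continuous_borel_integrable; [exact: cptM|exact: cu].
  - rewrite ler_pdivrMr// (subadditive_potential_le_linear hPhi)// => y.
    exact: le_trans (ler_norm _) (PhiC y).
  - apply: filterS hneg => x [l xl l0].
    have ul : (fun n => (u n x)%:E) @ \oo --> l by rewrite -cvg_shiftS in xl.
    by rewrite (cvg_limn_einf_sup ul).2.
exists n.+1 => //; move: un0; rewrite RintegralZr//.
  by rewrite pmulr_llt0.
exact/continuous_borel_integrable/hPhi.1.
Qed.

Lemma limn_einf_growth_lt0 (x : M) (n : nat) (nu : probability (borel M) R) :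
  (0 < n)%N -> empirical_limits f x nu -> \int[nu]_y Phi n y < 0 ->
  (limn_einf (growth Phi x) < 0)%E.
Proof.
move=> n0 [s s_incr snu]; set I := \int[nu]_y Phi n y => I0.
have cPhi := hPhi.1 n n0.
have [B PhiB] : exists B, forall k y, (0 < k < n.*2)%N -> `|Phi k y| <= B.
  have /choice[b Phib] k : exists b, (0 < k)%N -> forall y, `|Phi k y| <= b.
    have [->|k0] := posnP k; first by exists 0.
    by have [b] := continuous_bounded cptM (hPhi.1 k k0); exists b.
  exists (\sum_(k < n.*2) `|b k|) => k y /andP[k0 kn].
  rewrite (le_trans (Phib k k0 y))// (le_trans (ler_norm _))//.
  by rewrite (bigD1 (Ordinal kn))//= lerDl sumr_ge0.
pose K := 4 * n%:R * B.
have birkhoff N := subadditive_potential_le_birkhoff hPhi n0 PhiB (N := N) x.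
have n0R : 0 < n%:R :> R by rewrite ltr0n.
have sI : (\sum_(j < (s k).+1) Phi n (iter j f x)) / (s k).+1%:R
    @[k --> \oo] --> I.
  under eq_fun do rewrite -Rintegral_empirical//.
  exact: (cvg_comp _ _ snu (@integrate_continuous _ _ _ cPhi nu)).
have {}sI : \forall k \near \oo,
    (\sum_(j < (s k).+1) Phi n (iter j f x)) / (s k).+1%:R < I / 2.
  by apply: cvgr_lt sI _ _; lra.
(* Along the subsequence the averages of phi_n fall below I/2, and the error K/N is at most -I/4; so
   n phi_N(x) / N is at most I/4. *)
suff : (limn_einf (growth Phi x) <= (I / (4 * n%:R))%:E)%E.
  move=> /le_lt_trans; apply; rewrite lte_fin pmulr_llt0// invr_gt0; lra.
apply: limn_einf_le => N0.
have s_ge k : (k <= s k)%N.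
  by elim: k => // k IH; exact: leq_ltn_trans IH (s_incr _ _ (ltnSn k)).
have [k [sk Nk nk Kk]] : exists k, [/\
    (\sum_(j < (s k).+1) Phi n (iter j f x)) / (s k).+1%:R < I / 2,
    (N0 <= k)%N, (n <= k)%N & K / (- I / 4) <= k%:R].
  have : \forall k \near \oo, [/\
    (\sum_(j < (s k).+1) Phi n (iter j f x)) / (s k).+1%:R < I / 2,
    (N0 <= k)%N, (n <= k)%N & K / (- I / 4) <= k%:R].
    near=> k; split; near: k => //; try exact: nbhs_infty_ge.
    exact: nbhs_infty_ger.
  by move=> /filter_ex.
have kN : (k <= (s k).+1)%N by rewrite leqW.
(* [empirical] with index [s k] averages over [(s k).+1] points, hence this value of N. *)
exists (s k).+1; first exact: leq_trans kN.
have kNR : k%:R <= (s k).+1%:R :> R by rewrite ler_nat.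
have := birkhoff _ (leq_trans nk kN); rewrite -/K lee_fin => Phis.
move: sk; rewrite ltr_pdivrMr// => sk.
move: Kk; rewrite ler_pdivrMr; last by lra.
move=> Kk.
have : k%:R * (- I / 4) <= (s k).+1%:R * (- I / 4) by rewrite ler_wpM2r//; lra.
rewrite ler_pdivrMr// mulrAC ler_pdivlMr; last by lra.
lra.
Unshelve. all: by end_near. Qed.

End growth.

Theorem corollary3p2 (R : realType) (d : nat) (M : ptopologicalType)
  (A : set (chart R d M)) (hM : is_manifold A) (cptM : compact [set: M])
  (m : probability (borel M) R) (hm : is_lebesgue_measure A m)
  (dist : probability (borel M) R -> probability (borel M) R -> R)
  (hdist : weak_star_metric dist)
  (f : M -> M) (hf : continuous f)
  (Phi : nat -> M -> R) (hPhi : subadditive_potential f Phi)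
  (mu : probability (borel M) R) (hmu : observable m f dist mu)
  (hneg : {ae mu, forall x : borel M,
             exists2 l : \bar R, growth Phi x @ \oo --> l & (l < 0)%E}) :
  (0 < m [set x : borel M | (limn_einf (growth Phi x) < 0)%E])%E.
Proof.
have [n n0 Phin0] := exists_Rintegral_lt0 cptM hPhi hneg.
have cPhi := hPhi.1 n n0.
(* Negativity of the integral is a weak* open condition, so it holds on a ball around [mu]. *)
have [e e0 eN] : exists2 e : R, 0 < e &
    [set nu | dist mu nu < e] `<=`
    [set nu : probability (borel M) R | \int[nu]_x Phi n x < 0].
  have [_ _ _ nbhs_dist] := hdist.
  have /cvgr_lt/(_ _ Phin0) := @integrate_continuous _ _ _ cPhi mu.
  by rewrite nbhs_dist.
set S := [set x | _].
have mS : measurable (S : set (borel M)).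
  rewrite -[S]setTI; apply: emeasurable_fun_infty_o => //.
  apply: measurable_fun_limn_einf => k; exact: measurable_fun_growth hPhi k.
(* The basin need not be known to be Borel, so the comparison is made with the outer measure. *)
rewrite -(measurable_mu_extE m mS) (lt_le_trans (hmu e e0))//.
apply: le_mu_ext => x [nu [xnu mu_nu]].
exact: (limn_einf_growth_lt0 cptM hPhi n0 xnu (eN _ mu_nu)).
Qed.
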